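(* Let $A$ and $C$ be two events with $AC\neq\emptyset$. If $P(C|A)>0$, then $\mathbb{P}[A|(C|A)]=P(A)$.
   Context: Events. An event is a two-valued (true/false) logical entity, identified with its $0/1$ indicator; $\Omega$ and $\emptyset$ are the sure and impossible events, $AB$ denotes $A\wedge B$, and $\overline{A}$ is the negation of $A$. The constituents generated by finitely many events are the non-impossible conjunctions obtained by choosing each event or its negation. Conditional random quantities. For an event $H\neq\emptyset$ and a finite-valued random quantity $X$ with assessed prevision $\mathbb{P}(X|H)=\mu$, the conditional random quantity $X|H$ is $X|H=XH+\mu\overline{H}$. When $X$ is (the indicator of) an event $A$, $\mathbb{P}(A|H)=P(A|H)$ and $A|H$ is the (indicator of the) conditional event, with values $1$, $0$, $P(A|H)$ according to whether $AH$, $\overline{A}H$, $\overline{H}$ is true. Iterated conditional. For events $A,C,D$ with $AC\ne\emptyset$ and $x=P(C|A)$, the conjunction $D\wedge(C|A)$ is the random quantity with values $1$ if $ACD$ is true, $0$ if $\overline{D}\vee A\overline{C}$ is true, $x$ if $\overline{A}D$ is true. The iterated conditional $D|(C|A)$ is $$D|(C|A)=D\wedge(C|A)+\mu(1-C|A),$$ where $\mu=\mathbb{P}[D|(C|A)]=\mathbb{P}[D\wedge(C|A)+\mu(1-C|A)]$. In particular, for $D=A$, $A|(C|A)=AC+\mu(1-C|A)$ takes the values $1$ on $AC$, $\mu(1-x)$ on $\overline{A}$, $\mu$ on $A\overline{C}$, with $\mu=\mathbb{P}[A|(C|A)]$. Coherence. A bet on an object $Z$ (conditional event, conditional random quantity,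 iterated conditional) with assessed prevision $\mu$ and stake $s\in\mathbb{R}$ has random gain $s(Z-\mu)$. The bet is called off in a constituent if there one receives back the paid amount $\mu$ whatever the value of $\mu$ (for $X|H$: when $\overline{H}$ is true; for an iterated conditional this may depend on the preliminary probability values, e.g. on whether $x=0$). An assessment of previsions is coherent if, for every finite subfamily of objects and all real stakes, the total gain $G$, restricted to the constituents in which not all the bets are called off, satisfies $\min G\le 0\le\max G$. Coherent previsions are linear. All probabilities and previsions are assumed to come from a coherent assessment on all objects involved. *)

(* Defs.v *)
From HB Require Import structures.
From mathcomp Require Import all_boot all_order all_algebra.
From mathcomp Require Import boolp classical_sets functions cardinality reals.
From mathcomp Require Import numfun.
Set Implicit Arguments.
Unset Strict Implicit.
Unset Printing Implicit Defensive.
Import Order.TTheory GRing.Theory Num.Theory.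
Local Open Scope classical_set_scope.
Local Open Scope ring_scope.

(* Events are sets of elementary possibilities w : W.  No structure on W is
   assumed, so the events involved may satisfy arbitrary logical relations; the
   sure and impossible events are setT and set0. *)

Section Coherence.
Variables (R : realType) (W : Type).

(* CondRQ X H is X|H for a finite-valued random quantity X.
   IterCond D C A is D|(C|A). *)
Inductive object : Type :=
| CondRQ of (W -> R) & set W
| IterCond of set W & set W & set W.

Definition cond_event (E H : set W) : object := CondRQ \1_E H.

Definition event (E : set W) : object := cond_event E setT.

Definition admissible (o : object) : Prop :=
  match o with
  | CondRQ X H => finite_set (range X) /\ H !=set0
  | IterCond D C A => A `&` C !=set0
  end.

Definition cond_rq (X : W -> R) (H : set W) (m : R) (w : W) : R :=
  X w * \1_H w + m * \1_(~` H) w.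

(* D /\ (C|A), where x is the probability of C|A. *)
Definition conj_cond (D C A : set W) (x : R) (w : W) : R :=
  \1_(A `&` C `&` D) w + x * \1_(~` A `&` D) w.

(* The value of the object o at w when m is paid for o; the assessment P only
   enters through the preliminary value x = P(C|A) of an iterated conditional. *)
Definition payoff (P : object -> R) (o : object) (m : R) (w : W) : R :=
  match o with
  | CondRQ X H => cond_rq X H m w
  | IterCond D C A =>
      let x := P (cond_event C A) in
      conj_cond D C A x w + m * (1 - cond_rq \1_C A x w)
  end.

Definition generators (o : object) : set (set W) :=
  match o with
  | CondRQ X H => [set H] `|` [set X @^-1` [set r] | r in range X]
  | IterCond D C A => [set D] `|` [set C] `|` [set A]
  end.

Definition constituents (Es : set (set W)) : set (set W) :=
  [set K | K !=set0 /\
    exists e : set W -> bool,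
      K = \bigcap_(E in Es) (if e E then E else ~` E)].

Definition called_off (P : object -> R) (o : object) (K : set W) : Prop :=
  forall m w, K w -> payoff P o m w = m.

Definition gain (P : object -> R) n (o : 'I_n -> object) (s : 'I_n -> R)
    (w : W) : R :=
  \sum_(i < n) s i * (payoff P (o i) (P (o i)) w - P (o i)).

(* The payoffs are constant on each constituent, so these are finitely many
   values, one for each constituent in which not all the bets are called off. *)
Definition gain_values (P : object -> R) n (o : 'I_n -> object)
    (s : 'I_n -> R) : set R :=
  [set g | exists2 K,
    constituents (\bigcup_(i in [set: 'I_n]) generators (o i)) K &
    ~ (forall i, called_off P (o i) K) /\
    exists2 w, K w & gain P o s w = g].

(* P is coherent on the family F.  A finite subfamily is indexed by 'I_n with
   n > 0; repetitions are harmless, as they amount to adding up the stakes.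
   The two existentials say that min G <= 0 <= max G. *)
Definition coherent (F : set object) (P : object -> R) : Prop :=
  F `<=` admissible /\
  forall n (o : 'I_n -> object) (s : 'I_n -> R),
    (0 < n)%N -> (forall i, F (o i)) ->
    (exists2 g, gain_values P o s g & g <= 0) /\
    (exists2 g, gain_values P o s g & 0 <= g).

End Coherence.

Arguments CondRQ {R W} _ _.
Arguments IterCond {R W} _ _ _.
Arguments cond_event {R W} _ _.
Arguments event {R W} _.

(* Main.v *)
Require Import Defs.
From mathcomp Require Import all_boot all_order all_algebra.
From mathcomp Require Import boolp classical_sets reals.
From mathcomp Require Import numfun ring.
Import Order.TTheory GRing.Theory Num.Theory.
Local Open Scope classical_set_scope.
Local Open Scope ring_scope.

(** Write p = P(A), x = P(C|A) and mu for the prevision of A|(C|A).  The net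
    gains of unit bets on the three objects are

<<
                      AC        A~C       ~A
      A             1 - p     1 - p      - p
      C|A           1 - x       - x        0
      A|(C|A)      1 - mu         0   - mu x
>>

    If q is a probability on the three columns for which all rows have mean 0,
    the second row gives q(AC) = p x, and then the third gives
    p x (1 - mu) = (1 - p) mu x, that is mu = p as soon as x <> 0.  Dually, this
    elimination is a combination of bets: the stakes - x, - (1 - mu) and 1 make
    the three columns equal, so that the total gain is the sure amount
    x (p - mu) ([gain_hedged]).  Coherence forbids a nonzero sure gain
    ([coherent_sure_gain_eq0]), whence x (p - mu) = 0, and
    mu = p because x > 0. *)

(** A sure gain is both the minimum and the maximum of the gain, whichever
    constituents are discarded because all the bets are called off there. *)
Lemma coherent_sure_gain_eq0 (R : realType) (W : Type)
    (F : set (object R W)) (P : object R W -> R) (n : nat)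
    (o : 'I_n -> object R W) (s : 'I_n -> R) (k : R) :
  coherent F P -> (0 < n)%N -> (forall i, F (o i)) ->
  (forall w, gain P o s w = k) -> k = 0.
Proof.
move=> [_ coh] n_gt0 Fo gaink; apply/eqP; rewrite eq_le.
have [[g [K _ [_ [w _ <-]]]] + [h [L _ [_ [v _ <-]]]]] := coh n o s n_gt0 Fo.
by rewrite !gaink => -> ->.
Qed.

Definition three_objects (R : realType) (W : Type) (A C : set W) :
    'I_3 -> object R W :=
  tnth [tuple event A; cond_event C A; IterCond A C A].

(** The stakes that equalize the three columns of the table of gains, up to
    a common factor, which is fixed by a unit stake on the iterated
    conditional. *)
Definition hedging_stakes (R : realType) (W : Type) (A C : set W)
    (P : object R W -> R) : 'I_3 -> R :=
  tnth [tuple - P (cond_event C A); - (1 - P (IterCond A C A)); 1].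

Lemma gain_hedged (R : realType) (W : Type) (A C : set W)
    (P : object R W -> R) (w : W) :
  gain P (three_objects R W A C) (hedging_stakes R W A C P) w =
  P (cond_event C A) * (P (event A) - P (IterCond A C A)).
Proof.
rewrite /gain !big_ord_recl big_ord0 /three_objects /hedging_stakes.
rewrite !(tnth_nth (event A)) !(tnth_nth 0) /=.
rewrite /conj_cond /cond_rq !indicE !in_setI !in_setC in_setT.
by case: (w \in A); case: (w \in C) => /=; ring.
Qed.

Theorem theorem7 (R : realType) (W : Type) (A C : set W)
    (F : set (object R W)) (P : object R W -> R) :
  A `&` C !=set0 ->
  coherent F P ->
  F (event A) -> F (cond_event C A) -> F (IterCond A C A) ->
  0 < P (cond_event C A) ->
  P (IterCond A C A) = P (event A).
Proof.
move=> _ coh FA FCA FACA x_gt0.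
have Fo i : F (three_objects R W A C i).
  by case: i => [[|[|[|]]]] // ?; rewrite /three_objects (tnth_nth (event A)).
have /eqP : P (cond_event C A) * (P (event A) - P (IterCond A C A)) = 0.
  by apply: coherent_sure_gain_eq0 coh _ Fo (gain_hedged R W A C P).
by rewrite mulf_eq0 gt_eqF //= subr_eq0 => /eqP ->.
Qed.
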